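(* Let $C$ be a multi-rotationally symmetric planar convex body (different from a circle), with maximal degree $k_C$ and minimal degree $\chi_C=2$. Let $\{k_1=\chi_C,k_2,\ldots,k_n=k_C\}$ be the set of divisors of $k_C$ (greater than $1$), with $k_1<k_2<\ldots<k_n$. Then $$d_M(P_2)>d_M(P_{k_2})\geq\ldots\geq d_M(P_{k_n}),$$ where $P_k$ is the standard $k$-partition associated to $C$.
   Context: A planar convex body is a compact convex subset of $\mathbb{R}^2$ with non-empty interior; ''circle'' means a disk. For $k\in\mathbb{N}$, $k\geq 2$, a planar convex body $C$ is $k$-rotationally symmetric if there is a point $p\in C$ (the center of symmetry of $C$) such that $C$ is invariant under the rotation of angle $2\pi/k$ about $p$. $C$ is multi-rotationally symmetric if it is $k$-rotationally symmetric for more than one value of $k$. The minimal degree $\chi_C$ is the smallest $k\geq 2$ for which $C$ is $k$-rotationally symmetric; if $C$ is not a circle, the maximal degree $k_C$ is the largest such $k$. $C$ is $k$-rotationally symmetric exactly when $k$ is a divisor of $k_C$ greater than $1$. Standard $k$-partition ($k\geq 2$): let $C$ be $k$-rotationally symmetric with center of symmetry $p$. Let $x_1,\ldots,x_k$ be points of $\partial C$ at minimal distance to $p$, symmetrically placed along $\partial C$ (they are the images of one such point under the rotations about $p$ of angles that are multiples of $2\pi/k$). The line segments $\overline{p\,x_i}$ divide $C$ into $k$ connected congruent (closed) subsets $C_1,\ldots,C_k$; this decomposition is the standard $k$-partition $P_k$ associated to $C$. The maximum relative diameter of a decomposition $P$ of $C$ into subsets $C_1,\ldots,C_k$ is $d_M(P)=\max\{D(C_i):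 i=1,\ldots,k\}$, where $D(C_i)=\max\{d(x,y):x,y\in C_i\}$ is the Euclidean diameter. *)

(* Defs.v *)
From HB Require Import structures.
From mathcomp Require Import all_boot all_order all_algebra.
From mathcomp Require Import all_classical all_reals all_analysis.
Set Implicit Arguments.
Unset Strict Implicit.
Unset Printing Implicit Defensive.
Import Order.TTheory GRing.Theory Num.Theory.
Import numFieldNormedType.Exports.
Local Open Scope classical_set_scope.
Local Open Scope ring_scope.

Section PlanarBodies.
Context {R : realType}.
Local Notation plane := 'rV[R]_2.
Implicit Types (C D : set plane) (p x y : plane) (k : nat).

(* The library norm on ['rV[R]_2] is the sup norm (with the same topology), so
   the Euclidean distance is written out. *)
Definition eucl_dist x y : R := Num.sqrt (\sum_i (x 0 i - y 0 i) ^+ 2).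

Definition rotation p (theta : R) x : plane :=
  let v := x - p in
  p + \row_j (if j == 0 then cos theta * v 0 0 - sin theta * v 0 1
                        else sin theta * v 0 0 + cos theta * v 0 1).

Definition boundary D : set plane := closure D `\` D°.

Definition convex_body C : Prop :=
  [/\ compact C, convex_set C & C° !=set0].

Definition is_disk C : Prop :=
  exists c (r : R), 0 < r /\ C = [set x | eucl_dist c x <= r].

Definition symmetry_center C k p : Prop :=
  C p /\ rotation p (2 * pi / k%:R) @` C = C.

Definition rot_symmetric C k : Prop :=
  (2 <= k)%N /\ exists p, symmetry_center C k p.

Definition multi_rot_symmetric C : Prop :=
  exists k l, [/\ k <> l, rot_symmetric C k & rot_symmetric C l].

Definition minimal_degree C k : Prop :=
  rot_symmetric C k /\ forall l, rot_symmetric C l -> (k <= l)%N.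

Definition maximal_degree C k : Prop :=
  rot_symmetric C k /\ forall l, rot_symmetric C l -> (l <= k)%N.

Definition segment p x : set plane :=
  [set (1 - t) *: p + t *: x | t in `[0, 1]].

(* [nearest_boundary_point C p x]: x is a point of the boundary of C at minimal
   distance to p. *)
Definition nearest_boundary_point C p x : Prop :=
  boundary C x /\ forall y, boundary C y -> eucl_dist p x <= eucl_dist p y.

(* The union of the segments from p to the k images of x under the rotations
   about p of angles multiple of 2 pi / k. *)
Definition cuts k p x : set plane :=
  \bigcup_(i in `I_k) segment p (rotation p (i%:R * (2 * pi / k%:R)) x).

(* The closed pieces into which a set S divides C: the closures of the
   connected components of C minus S. *)
Definition pieces C (S : set plane) : set (set plane) :=
  [set closure (connected_component (C `\` S) x) | x in C `\` S].

(* A decomposition is the set of its members. The nearest boundary point need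
   not be unique up to the symmetries of C, so being a standard k-partition is
   a relation. *)
Definition standard_partition C k (P : set (set plane)) : Prop :=
  exists p x, [/\ symmetry_center C k p, nearest_boundary_point C p x
    & P = pieces C (cuts k p x)].

(* The suprema are attained for nonempty compact D and for finite P. *)
Definition diameter D : R := sup [set eucl_dist x y | x in D & y in D].

Definition max_rel_diameter (P : set (set plane)) : R :=
  sup [set diameter D | D in P].

End PlanarBodies.

(* Main.v *)
Require Import Defs.
From HB Require Import structures.
From mathcomp Require Import all_boot all_order all_algebra.
From mathcomp Require Import all_classical all_reals all_analysis.
From mathcomp Require Import ring lra.
Set Implicit Arguments.
Unset Strict Implicit.
Unset Printing Implicit Defensive.
Import Order.TTheory GRing.Theory Num.Theory.
Import numFieldNormedType.Exports.
Local Open Scope classical_set_scope.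
Local Open Scope ring_scope.

(** Let p be the center of C, let r be the distance from p to the boundary and
    let d be the largest distance from p to a point of C. All the symmetries of C
    have the same center p, since otherwise C would be invariant under the
    half-turns about two distinct points, whose product is a translation
    ([symmetry_center_unique]); so r and d are common to all the standard
    partitions. The order kC is even, because the
    half-turn and a symmetry of odd order k generate one of order 2k
    ([double_symmetry]).

    For k >= 3 the maximum relative diameter of P_k is the larger of d and of the
    chord 2 r sin (pi / k) joining two consecutive feet x_i, x_(i+1) of the cuts.
    The square of that chord is written 2 r^2 (1 - cos (2 pi / k)). As the chord
    decreases with k, the maximum relative diameter does not increase.

    - Upper bound ([max_rel_diameter_le_kite]). C lies in the half-planes bounded
      by the tangents at the feet to the inscribed circle ([support_tangent]), so a
      piece lies in the kite with vertices p, x_i, x_(i+1) and the meeting point w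
      of the two tangents. The diagonal x_i x_(i+1) cuts the kite into two
      isosceles triangles. The angle at w is pi - 2 pi / k, which is at least
      pi / 3 exactly when k >= 3, and then the diagonal is the longest side of the
      triangle with apex w. Two points of the same triangle, or one of each, are
      therefore at distance at most the diagonal, or r, or the distance from p to
      a point of C ([kite_diameter]).
    - Lower bound ([max_rel_diameter_ge]). By rotating a farthest point into the
      first sector, one gets a single piece that contains p, x_0, x_1 and a point
      at distance d from p ([first_piece_points]). This holds for k = 2 as well.

    For k = 2 the feet are x and its reflection, at distance 2 r > sqrt 3 r, and
    sqrt 3 r bounds the chord for every k >= 3. By the parallelogram law, a point
    of the piece at distance d from p is at distance at least
    sqrt (d^2 + r^2) > d from one of the feet. Both strict inequalities give
    [max_rel_diameter_half_gt], hence the strict first step of the chain. *)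

(** * Coordinates, rotations and squared distances *)

Section Plane.
Context {R : realType}.
Local Notation plane := 'rV[R]_2.
Implicit Types (p q u v w x y z : plane) (a b t : R).

Definition abscissa y : R := y 0 0.
Definition ordinate y : R := y 0 1.
Local Notation X := abscissa.
Local Notation Y := ordinate.

(** Inner and cross product of the vectors from [p] to [x] and to [y]: keeping the
    base point avoids translating the body. *)
Definition dot p x y : R := (X x - X p) * (X y - X p) + (Y x - Y p) * (Y y - Y p).
Definition cross p x y : R := (X x - X p) * (Y y - Y p) - (Y x - Y p) * (X y - X p).
Definition sqd x y : R := (X x - X y) ^+ 2 + (Y x - Y y) ^+ 2.

Lemma eucl_distE x y : eucl_dist x y = Num.sqrt (sqd x y).
Proof.
rewrite /eucl_dist big_ord_recl big_ord1 /sqd /X /Y.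
by rewrite (_ : lift ord0 ord0 = 1) //; apply: val_inj.
Qed.

Lemma sqd_ge0 x y : 0 <= sqd x y.
Proof. by rewrite addr_ge0 ?sqr_ge0. Qed.

Lemma plane_ext x y : X x = X y -> Y x = Y y -> x = y.
Proof.
move=> hX hY; apply/rowP => i; case: i => [[|[|//]] h].
- by rewrite (_ : Ordinal h = 0); [exact: hX|apply: val_inj].
- by rewrite (_ : Ordinal h = 1); [exact: hY|apply: val_inj].
Qed.

Lemma abscissaE a b x y : X (a *: x + b *: y) = a * X x + b * X y.
Proof. by rewrite /X !mxE. Qed.

Lemma ordinateE a b x y : Y (a *: x + b *: y) = a * Y x + b * Y y.
Proof. by rewrite /Y !mxE. Qed.

Lemma abscissa_rotation p a x :
  X (rotation p a x) = X p + (cos a * (X x - X p) - sin a * (Y x - Y p)).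
Proof. by rewrite /rotation /X /Y !mxE /=. Qed.

Lemma ordinate_rotation p a x :
  Y (rotation p a x) = Y p + (sin a * (X x - X p) + cos a * (Y x - Y p)).
Proof. by rewrite /rotation /X /Y !mxE /=. Qed.

Definition coordE :=
  (abscissaE, ordinateE, abscissa_rotation, ordinate_rotation).

Lemma sqd_eq0 x y : sqd x y = 0 -> x = y.
Proof.
move/eqP; rewrite paddr_eq0 ?sqr_ge0// !sqrf_eq0 !subr_eq0 => /andP[/eqP hX /eqP hY].
exact: plane_ext.
Qed.

Lemma rotationD p a b x : rotation p a (rotation p b x) = rotation p (a + b) x.
Proof. by apply: plane_ext; rewrite !coordE cosD sinD; ring. Qed.

Lemma rotation0 p x : rotation p 0 x = x.
Proof. by apply: plane_ext; rewrite !coordE cos0 sin0; ring. Qed.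

Lemma rotation_pi p x : rotation p pi x = 2 *: p + (-1) *: x.
Proof. by apply: plane_ext; rewrite !coordE cospi sinpi; ring. Qed.

Lemma rotation_periodic p a n x : rotation p (a + n%:R * (2 * pi)) x = rotation p a x.
Proof.
have E : n%:R * (2 * pi) = pi *+ 2 *+ n :> R by rewrite -[RHS]mulr_natl mulr2n; ring.
by apply: plane_ext; rewrite !coordE E
  (periodicn (@sinD2pi R)) (periodicn (@cosD2pi R)).
Qed.

Lemma cos2Dsin2_sub1 a : (cos a - 1) ^+ 2 + sin a ^+ 2 = 2 * (1 - cos a) :> R.
Proof. by have := cos2Dsin2 a; nra. Qed.

Lemma rotation_dot p a b x :
  dot p (rotation p a x) (rotation p b x) = cos (b - a) * sqd p x.
Proof. by rewrite /dot /sqd !coordE cosB; ring. Qed.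

Lemma rotation_cross p a b x :
  cross p (rotation p a x) (rotation p b x) = sin (b - a) * sqd p x.
Proof. by rewrite /cross /sqd !coordE sinB; ring. Qed.

Lemma cross_rotationl p a x y :
  cross p (rotation p a x) y = cos a * cross p x y - sin a * dot p x y.
Proof. by rewrite /cross /dot !coordE; ring. Qed.

Lemma cross_rotation2 p a x y :
  cross p (rotation p a x) (rotation p a y) = cross p x y.
Proof.
rewrite -[RHS]mul1r -(cos2Dsin2 a) /cross !coordE; ring.
Qed.

Lemma dot_rotation2 p a x y :
  dot p (rotation p a x) (rotation p a y) = dot p x y.
Proof.
rewrite -[RHS]mul1r -(cos2Dsin2 a) /dot !coordE; ring.
Qed.

Lemma sqd_rotation p a x : sqd p (rotation p a x) = sqd p x.
Proof.
rewrite -[RHS]mul1r -(cos2Dsin2 a) /sqd !coordE; ring.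
Qed.

Lemma crossC p x y : cross p x y = - cross p y x.
Proof. by rewrite /cross; ring. Qed.

Lemma sqdC x y : sqd x y = sqd y x.
Proof. by rewrite /sqd; ring. Qed.

Lemma sqd_dot p x y : sqd x y = sqd p x + sqd p y - 2 * dot p x y.
Proof. by rewrite /dot /sqd; ring. Qed.

(** A turn of angle [2 pi / k] with [k >= 2] is not the identity. *)
Lemma cos_turn_lt1 k : (2 <= k)%N -> cos (2 * pi / k%:R) < 1 :> R.
Proof.
move=> k2; have k0 : 0 < k%:R :> R by rewrite ltr0n; case: k k2.
have -> : 2 * pi / k%:R = (pi / k%:R) *+ 2 :> R by rewrite -[RHS]mulr_natl; ring.
have s0 : 0 < sin (pi / k%:R) :> R.
  rewrite sin_gt0_pi// divr_gt0 ?pi_gt0//= ltr_pdivrMr//.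
  by rewrite ltr_pMr ?pi_gt0// ltr1n.
by rewrite cos_mulr2n cos2sin2 -mulr_natr; nra.
Qed.

Lemma abscissa_continuous : continuous X.
Proof. exact: coord_continuous. Qed.

Lemma ordinate_continuous : continuous Y.
Proof. exact: coord_continuous. Qed.

Lemma fun_addr_continuous (f g : plane -> R) :
  continuous f -> continuous g -> continuous (fun y => f y + g y).
Proof. by move=> cf cg y; apply: (@continuousD _ _ _ f g); [exact: cf|exact: cg]. Qed.

Lemma fun_mulr_continuous (f g : plane -> R) :
  continuous f -> continuous g -> continuous (fun y => f y * g y).
Proof. by move=> cf cg y; apply: (@continuousM _ _ f g); [exact: cf|exact: cg]. Qed.

Lemma affine_continuous a b t : continuous (fun y => a * X y + b * Y y + t).
Proof.
apply: fun_addr_continuous; last exact: cst_continuous.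
apply: fun_addr_continuous; (apply: fun_mulr_continuous; first exact: cst_continuous).
  exact: abscissa_continuous.
exact: ordinate_continuous.
Qed.

Lemma sqd_continuous p : continuous (sqd p).
Proof.
have -> : sqd p = fun y => (-1 * X y + 0 * Y y + X p) * (-1 * X y + 0 * Y y + X p)
    + (0 * X y + -1 * Y y + Y p) * (0 * X y + -1 * Y y + Y p).
  by apply/funext => y; rewrite /sqd; ring.
by apply: fun_addr_continuous; apply: fun_mulr_continuous; exact: affine_continuous.
Qed.

Lemma cross_continuous p x : continuous (cross p x).
Proof.
have -> : cross p x = fun y => - (Y x - Y p) * X y + (X x - X p) * Y y +
    ((Y x - Y p) * X p - (X x - X p) * Y p).
  by apply/funext => y; rewrite /cross; ring.
exact: affine_continuous.
Qed.

Lemma closed_ge_comp (f : plane -> R) a : continuous f -> closed [set y | a <= f y].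
Proof.
move=> cf.
exact: (@preimage_closed _ _ f [set x | a <= x] (fun y _ => cf y) (@closed_ge _ a)).
Qed.

Lemma open_gt_comp (f : plane -> R) a : continuous f -> open [set y | a < f y].
Proof.
by move=> cf; exact: (@open_comp _ _ f [set x | a < x] (fun y _ => cf y) (@open_gt _ a)).
Qed.

Lemma open_lt_comp (f : plane -> R) a : continuous f -> open [set y | f y < a].
Proof.
by move=> cf; exact: (@open_comp _ _ f [set x | x < a] (fun y _ => cf y) (@open_lt _ a)).
Qed.

Lemma segment_path_continuous x y : continuous (fun t : R => (1 - t) *: x + t *: y).
Proof.
move=> t.
apply: (@continuousD _ _ _ (fun t : R => (1 - t) *: x) (fun t : R => t *: y)).
  apply: (@continuousZr_tmp _ _ _ (fun t : R => 1 - t)).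
  apply: (@continuousB _ R^o _ (fun=> 1) (fun t : R => t)); first exact: cst_continuous.
  exact: cvg_id.
by apply: (@continuousZr_tmp _ _ _ (fun t : R => t)); exact: cvg_id.
Qed.

Lemma segment_is_connected x y : connected (segment x y).
Proof.
apply: (@connected_continuous_connected _ _ _ (fun t : R => (1 - t) *: x + t *: y)).
  exact: segment_connected.
by apply: continuous_subspaceT => t; exact: segment_path_continuous.
Qed.

Lemma convex_setP (C : set plane) x y t : convex_set C -> C x -> C y ->
  0 <= t <= 1 -> C ((1 - t) *: x + t *: y).
Proof.
move=> cC Cx Cy /andP[t0 t1].
have := cC y x (Itv01 t0 t1); rewrite !inE => /(_ Cy Cx).
by rewrite /conv/= addrC.
Qed.

End Plane.

(** * The diameter of a kite truncated by a disk *)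

Section Kite.
Context {R : realType}.
Local Notation plane := 'rV[R]_2.
Implicit Types (p q u v w x y z : plane) (a b t M : R).
Local Notation X := abscissa.
Local Notation Y := ordinate.

(** The factor [1 *:] makes every combination a sum of two scaled points, the only
    shape that the coordinate lemmas have to handle. *)
Definition in_triangle u v w y : Prop :=
  exists a b t, [/\ 0 <= a, 0 <= b, 0 <= t & a + b + t = 1 /\
    y = a *: u + 1 *: (b *: v + t *: w)].

Lemma in_triangle_vertex u v w :
  [/\ in_triangle u v w u, in_triangle u v w v & in_triangle u v w w].
Proof.
split; [exists 1, 0, 0|exists 0, 1, 0|exists 0, 0, 1];
  (split; [lra|lra|lra|split; [lra|apply: plane_ext; rewrite !coordE; ring]]).
Qed.

(** Convexity of the squared distance to [z]: the defect in Jensen's inequality is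
    the sum of the products of two weights with the squared length of a side. *)
Lemma in_triangle_sqd_le u v w y z M : in_triangle u v w y ->
  sqd u z <= M -> sqd v z <= M -> sqd w z <= M -> sqd y z <= M.
Proof.
move=> [a [b [t [a0 b0 t0 [s1 ->]]]]] hu hv hw.
have E : sqd (a *: u + 1 *: (b *: v + t *: w)) z =
    a * sqd u z + b * sqd v z + t * sqd w z
    - (a * b * sqd u v + a * t * sqd u w + b * t * sqd v w).
  have -> : t = 1 - a - b by lra.
  by rewrite /sqd !coordE; ring.
have h1 : 0 <= a * b * sqd u v by rewrite !mulr_ge0 ?sqd_ge0.
have h2 : 0 <= a * t * sqd u w by rewrite !mulr_ge0 ?sqd_ge0.
have h3 : 0 <= b * t * sqd v w by rewrite !mulr_ge0 ?sqd_ge0.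
have := ler_wpM2l a0 hu; have := ler_wpM2l b0 hv; have := ler_wpM2l t0 hw.
have EM : a * M + b * M + t * M = M by rewrite -!mulrDl s1 mul1r.
lra.
Qed.

Lemma triangle_diameter u v w y z M :
  in_triangle u v w y -> in_triangle u v w z ->
  sqd u v <= M -> sqd u w <= M -> sqd v w <= M -> sqd y z <= M.
Proof.
move=> Ty Tz uv uw vw.
have M0 : 0 <= M by apply: le_trans uv; exact: sqd_ge0.
have s0 x : sqd x x <= M by rewrite /sqd !subrr expr0n /= addr0.
have P x : sqd x u <= M -> sqd x v <= M -> sqd x w <= M -> sqd x z <= M.
  by rewrite !(sqdC x); exact: in_triangle_sqd_le.
by apply: (in_triangle_sqd_le Ty); apply: P => //; rewrite sqdC.
Qed.

Definition sector p u v : set plane :=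
  [set y | 0 <= cross p u y /\ 0 <= cross p y v].
Definition open_sector p u v : set plane :=
  [set y | 0 < cross p u y /\ 0 < cross p y v].

(** The hypotheses make [u] and [v] points of a circle about [p] seen under an angle
    of cosine [c >= - 1 / 2]; the tangents at [u] and [v] meet at
    [w = p + ((u - p) + (v - p)) / (1 + c)]. Each of [y] and [z] lies in the
    triangle [p u v] or in the triangle [u v w], and [w u = w v <= u v] amounts
    to [1 / (1 + c) <= 2]. When [y] and [z] are in different triangles, the
    distance between them is bounded at the vertices of the first triangle: at
    [u] and [v], which are in both triangles, by the sides, and at [p] by
    hypothesis. *)
Lemma kite_diameter p u v y z c M :
  - (1 / 2) <= c -> c < 1 -> sqd p u = sqd p v -> dot p u v = c * sqd p u ->
  0 < cross p u v -> sqd p u <= M -> sqd u v <= M ->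
  sector p u v y -> dot p u y <= sqd p u -> dot p v y <= sqd p v -> sqd p y <= M ->
  sector p u v z -> dot p u z <= sqd p u -> dot p v z <= sqd p v -> sqd p z <= M ->
  sqd y z <= M.
Proof.
move=> c1 c2 uv duv cr uM uvM sy uy vy yM sz uz vz zM.
pose w := (1 - 2 / (1 + c)) *: p + (1 + c)^-1 *: (1 *: u + 1 *: v).
have c0 : 1 + c != 0 by apply: lt0r_neq0; lra.
have c0' : 1 - c != 0 by apply: lt0r_neq0; lra.
have r0 : 0 < sqd p u.
  rewrite lt_neqAle sqd_ge0 andbT eq_sym; apply/eqP => /sqd_eq0 E.
  by move: cr; rewrite -E /cross !subrr !mul0r subrr ltxx.
have K q : sector p u v q -> dot p u q <= sqd p u -> dot p v q <= sqd p v ->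
    in_triangle p u v q \/ in_triangle u v w q.
  move=> [s1 s2] d1 d2.
  pose a := cross p q v / cross p u v; pose b := cross p u q / cross p u v.
  have a0 : 0 <= a by rewrite divr_ge0 // ltW.
  have b0 : 0 <= b by rewrite divr_ge0 // ltW.
  have crn : cross p u v != 0 by rewrite gt_eqF.
  (* Cramer's rule in the frame [p; u, v] *)
  have Eq : q = (1 - a - b) *: p + 1 *: (a *: u + b *: v).
    apply: plane_ext; rewrite !coordE; apply: (mulfI crn);
      rewrite /a /b; set D := cross p u v in crn *;
      (have -> : forall P A B : R, D * ((1 - cross p q v / D - cross p u q / D) * P +
        1 * (cross p q v / D * A + cross p u q / D * B)) =
        D * P - (cross p q v + cross p u q) * P + cross p q v * A + cross p u q * B
        by move=> P A B; field); rewrite /D /cross; ring.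
  have du : a + b * c <= 1.
    have E : dot p u q = sqd p u * (a + b * c).
      transitivity (a * sqd p u + b * dot p u v); last by rewrite duv; ring.
      by rewrite {1}Eq /dot /sqd !coordE; ring.
    by move: d1; rewrite E -{2}[sqd p u]mulr1 ler_pM2l.
  have dv : a * c + b <= 1.
    have E : dot p v q = sqd p u * (a * c + b).
      transitivity (a * dot p u v + b * sqd p v); last by rewrite duv -uv; ring.
      by rewrite {1}Eq /dot /sqd !coordE; ring.
    by move: d2; rewrite E -uv -{2}[sqd p u]mulr1 ler_pM2l.
  have [ab|ab] := lerP (a + b) 1.
    by left; exists (1 - a - b), a, b; split => //; [lra|split; [ring|]].
  (* [w] has coordinates [1 / (1 + c)] on [u] and [v]; solving for its weight
     gives [(a + b - 1) (1 + c) / (1 - c)]. *)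
  right; exists ((1 - b - a * c) / (1 - c)), ((1 - a - b * c) / (1 - c)),
    ((a + b - 1) * (1 + c) / (1 - c)); split.
  - by apply: divr_ge0; lra.
  - by apply: divr_ge0; lra.
  - by apply: divr_ge0; [apply: mulr_ge0; lra|lra].
  - split; first by field.
    by rewrite Eq; apply: plane_ext; rewrite !coordE; field; rewrite c0 c0'.
(* [w u] and [w v] are tangent segments: their square is [r^2 (1 - c) / (1 + c)]. *)
have wM : sqd u w <= M /\ sqd v w <= M.
  have Euw : sqd u w = sqd p u * (1 - c) / (1 + c).
    have -> : sqd u w = (sqd p u * c ^+ 2 + sqd p v - 2 * c * dot p u v) / (1 + c) ^+ 2.
      by rewrite /w /sqd /dot !coordE; field.
    by rewrite duv -uv; field.
  have Evw : sqd v w = sqd p u * (1 - c) / (1 + c).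
    have -> : sqd v w = (sqd p v * c ^+ 2 + sqd p u - 2 * c * dot p u v) / (1 + c) ^+ 2.
      by rewrite /w /sqd /dot !coordE; field.
    by rewrite duv -uv; field.
  have Euv : sqd u v = 2 * (sqd p u * (1 - c)) by rewrite (sqd_dot p) duv -uv; ring.
  have H : sqd p u * (1 - c) / (1 + c) <= sqd u v.
    rewrite Euv ler_pdivrMr; last lra.
    have : 0 <= sqd p u * (1 - c) by apply: mulr_ge0; lra.
    nra.
  by rewrite Euw Evw; split; apply: le_trans uvM.
have {wM} [uw vw] := wM.
have [pT uT vT] := in_triangle_vertex p u v.
have [uT' vT' wT'] := in_triangle_vertex u v w.
have pv : sqd p v <= M by rewrite -uv.
have T2 q q' : in_triangle p u v q -> in_triangle u v w q' -> sqd p q' <= M -> sqd q q' <= M.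
  move=> Tq Tq' pq'; apply: (in_triangle_sqd_le Tq) => //.
    exact: (triangle_diameter uT' Tq').
  exact: (triangle_diameter vT' Tq').
case: (K y sy uy vy) => Ty; case: (K z sz uz vz) => Tz.
- exact: (triangle_diameter Ty Tz).
- exact: T2.
- by rewrite sqdC; exact: T2.
- exact: (triangle_diameter Ty Tz).
Qed.

End Kite.

(** * Inscribed circle, tangents and sectors *)

Section Body.
Context {R : realType}.
Local Notation plane := 'rV[R]_2.
Implicit Types (p q u v w x y z : plane) (a b t M : R) (C S : set plane).
Local Notation X := abscissa.
Local Notation Y := ordinate.

Lemma sqd_segment p y t : sqd p ((1 - t) *: p + t *: y) = t ^+ 2 * sqd p y.
Proof. by rewrite /sqd !coordE; ring. Qed.

(** A segment from the center to a point closer than the boundary meets [C] in a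
    subset that is both open and closed, as it avoids the boundary. *)
Lemma ball_subset C p x : C p -> nearest_boundary_point C p x -> closed C ->
  forall y, sqd p y < sqd p x -> C y.
Proof.
move=> Cp [_ hx] cC y yx.
have near q : sqd p q < sqd p x -> C q -> C° q.
  move=> qx Cq; apply: contrapT => nq.
  have /hx : boundary C q by split => //; exact: subset_closure.
  by rewrite !eucl_distE ler_sqrt ?sqd_ge0// leNgt qx.
have seg q : segment p y q -> sqd p q < sqd p x.
  move=> [t /=]; rewrite in_itv/= => /andP[t0 t1] <-.
  rewrite sqd_segment; apply: le_lt_trans yx.
  by apply: ler_piMl; rewrite ?sqd_ge0 ?expr_le1.
have E : segment p y `&` C = segment p y.
  apply: (segment_is_connected (x := p) (y := y)).
  - exists p; split => //; exists 0 => /=; first by rewrite in_itv/= lexx ler01.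
    by rewrite subr0 scale1r scale0r addr0.
  - exists C°; first exact: open_interior.
    apply/seteqP; split => q [Sq Cq]; split => //; last exact: interior_subset Cq.
    exact: near (seg _ Sq) Cq.
  - by exists C.
suff : segment p y y by rewrite -E => -[].
exists 1 => /=; first by rewrite in_itv/= lexx ler01.
by rewrite subrr scale1r scale0r add0r.
Qed.

(** If [y] were beyond the tangent at [x], then [x] would be an interior point: for
    small [t] the homothety of ratio [1 - t] and center [y] sends the inscribed
    disk to a disk inside [C] containing [x] in its interior. *)
Lemma support_tangent C p x : convex_set C -> boundary C x ->
  (forall y, sqd p y < sqd p x -> C y) -> forall y, C y -> dot p x y <= sqd p x.
Proof.
move=> vC [_ nx] ball y Cy; rewrite leNgt; apply/negP => lt; apply: nx.
pose d := dot p x y - sqd p x.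
have d0 : 0 < d by rewrite subr_gt0.
(* What is required of [t] is [0 < t < 1] and [t * sqd p y < d]. *)
pose t := d / (1 + d + sqd p y).
have y0 := sqd_ge0 p y.
have den : 0 < 1 + d + sqd p y by lra.
have t0 : 0 < t by rewrite divr_gt0.
have t1 : t < 1 by rewrite ltr_pdivrMr//; lra.
have td : t * sqd p y < d by rewrite /t mulrAC ltr_pdivrMr//; nra.
have t1' : 1 - t != 0 by rewrite gt_eqF// subr_gt0.
(* [f q < (1 - t)^2 r^2] says that [q] is in the image of the inscribed disk. *)
pose f q := sqd ((1 - t) *: p + t *: y) q.
have fC q : f q < (1 - t) ^+ 2 * sqd p x -> C q.
  move=> fq; pose q' := (1 - t)^-1 *: q + - (t / (1 - t)) *: y.
  have -> : q = (1 - t) *: q' + t *: y.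
    by apply: plane_ext; rewrite !coordE; field.
  apply: convex_setP => //; last by rewrite !ltW.
  apply: ball.
  have E : f q = (1 - t) ^+ 2 * sqd p q' by rewrite /f /sqd !coordE; field.
  by move: fq; rewrite E ltr_pM2l// exprn_gt0// subr_gt0.
have fx : f x < (1 - t) ^+ 2 * sqd p x.
  have -> : f x = sqd p x - 2 * t * dot p x y + t ^+ 2 * sqd p y.
    by rewrite /f /sqd /dot !coordE; ring.
  have -> : dot p x y = d + sqd p x by rewrite /d subrK.
  have := sqd_ge0 p x; nra.
apply: (filterS (P := [set q | f q < (1 - t) ^+ 2 * sqd p x])) => //.
apply: open_nbhs_nbhs; split => //.
by apply: open_lt_comp; exact: sqd_continuous.
Qed.

Lemma cross_eq0_colinear p u y : sqd p u != 0 -> cross p u y = 0 ->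
  y = (1 - dot p u y / sqd p u) *: p + (dot p u y / sqd p u) *: u.
Proof.
move=> u0 cr; apply: plane_ext; rewrite !coordE; apply: (mulfI u0).
- rewrite (_ : sqd p u * (_ + _) =
    sqd p u * X p + dot p u y * (X u - X p)); last by field.
  transitivity (sqd p u * X y + (Y u - Y p) * cross p u y); first by rewrite cr; ring.
  by rewrite /sqd /dot /cross; ring.
- rewrite (_ : sqd p u * (_ + _) =
    sqd p u * Y p + dot p u y * (Y u - Y p)); last by field.
  transitivity (sqd p u * Y y - (X u - X p) * cross p u y); first by rewrite cr; ring.
  by rewrite /sqd /dot /cross; ring.
Qed.

Lemma open_open_sector p u v : open (open_sector p u v).
Proof.
rewrite (_ : open_sector p u v =
  [set y | 0 < cross p u y] `&` [set y | cross p v y < 0]); last first.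
  by apply/seteqP; split => y [] h1; rewrite /= -1?oppr_gt0 -?crossC; split => //;
    rewrite /= ?[cross p v y]crossC ?oppr_lt0 // [cross p y v]crossC oppr_gt0.
by apply: openI; [apply: open_gt_comp|apply: open_lt_comp]; exact: cross_continuous.
Qed.

Lemma closed_sector p u v : closed (sector p u v).
Proof.
rewrite (_ : sector p u v =
  [set y | 0 <= cross p u y] `&` [set y | 0 <= cross p v (2 *: p + -1 *: y)]).
  apply: closedI; apply: closed_ge_comp; first exact: cross_continuous.
  rewrite (_ : (fun y => _) = (fun y => (Y v - Y p) * X y + - (X v - X p) * Y y +
     ((X v - X p) * Y p - (Y v - Y p) * X p))); first exact: affine_continuous.
  by apply/funext => y; rewrite /cross !coordE; ring.
have E y : cross p v (2 *: p + -1 *: y) = cross p y v by rewrite /cross !coordE; ring.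
by apply/seteqP; split => y [h1 h2]; split => //; move: h2; rewrite /= E.
Qed.

(** A point of [C] on the boundary of the sector is in one of the two cuts, so
    outside the cuts the closed sector and the open sector have the same trace on
    [C]; so the trace of the sector on the component is open and closed, hence is
    the whole component. *)
Lemma component_subset_sector C S p u v y :
  0 < cross p u v ->
  (forall z, C z -> dot p u z <= sqd p u) ->
  (forall z, C z -> dot p v z <= sqd p v) ->
  segment p u `<=` S -> segment p v `<=` S ->
  (C `\` S) y -> sector p u v y ->
  connected_component (C `\` S) y `<=` sector p u v.
Proof.
move=> uv Cu Cv Su Sv CSy sy.
have nz w : cross p u v != 0 -> w = u \/ w = v -> 0 < sqd p w.
  move=> cr hw; rewrite lt_neqAle sqd_ge0 andbT eq_sym; apply/eqP => /sqd_eq0 E.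
  by move: cr; case: hw => <-; rewrite -E /cross !subrr ?mul0r ?mulr0 subrr eqxx.
have u0 : 0 < sqd p u by apply: nz; [rewrite gt_eqF|left].
have v0 : 0 < sqd p v by apply: nz; [rewrite gt_eqF|right].
(* The support line at w keeps a point of C on the ray from p through w
   between p and w, hence in the cut. *)
have ray w z : 0 < sqd p w -> (C z -> dot p w z <= sqd p w) -> C z -> cross p w z = 0 ->
    0 <= dot p w z -> segment p w z.
  move=> w0 Cw Cz cr d0; exists (dot p w z / sqd p w) => /=.
    by rewrite in_itv/= divr_ge0 ?ler_pdivrMr ?mul1r ?Cw// ltW.
  by rewrite -cross_eq0_colinear// gt_eqF.
have key z : (C `\` S) z -> sector p u v z -> open_sector p u v z.
  move=> [Cz nSz] [z1 z2]; split; rewrite lt_neqAle ?z1 ?z2 andbT eq_sym;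
    apply/eqP => z0; apply: nSz.
  - apply: Su; apply: ray => //; first exact: Cu.
    have E : cross p z v * sqd p u = dot p u z * cross p u v.
      rewrite -[LHS]addr0 -(mulr0 (dot p u v)) -z0 /dot /cross /sqd; ring.
    by rewrite -(pmulr_lge0 _ uv) -E mulr_ge0// ltW.
  - apply: Sv; apply: ray => //; first exact: Cv.
      by rewrite crossC z0 oppr0.
    have E : cross p u z * sqd p v = dot p v z * cross p u v.
      rewrite -[LHS]addr0 -(mulr0 (dot p u v)) -z0 /dot /cross /sqd; ring.
    by rewrite -(pmulr_lge0 _ uv) -E mulr_ge0// ltW.
set D := connected_component _ _.
have DCS : D `<=` C `\` S by exact: connected_component_sub.
have E : D `&` sector p u v = D.
  apply: (component_connected (A := C `\` S) (x := y)).
  - by exists y; split => //; exact: connected_component_refl.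
  - exists (open_sector p u v); first exact: open_open_sector.
    apply/seteqP; split => z [Dz sz]; split => //; first exact: key (DCS _ Dz) sz.
    by case: sz => s1 s2; split; exact: ltW.
  - by exists (sector p u v) => //; exact: closed_sector.
by move=> z; rewrite -/D -E => -[].
Qed.

(** Every point [z] of the closed sector is the limit of the points [path t] with
    [t > 0], which the convexity of the open sector puts in the component
    of [y]. *)
Lemma sector_subset_closure_component C S p u v y :
  convex_set C -> C y -> open_sector p u v y ->
  (forall q, S q -> ~ open_sector p u v q) ->
  C `&` sector p u v `<=` closure (connected_component (C `\` S) y).
Proof.
move=> vC Cy [y1 y2] disj z [Cz [z1 z2]].
pose path t := (1 - t) *: z + t *: y.
have opath t : 0 < t -> t <= 1 -> C (path t) /\ open_sector p u v (path t).
  move=> t0 t1; split; first by apply: convex_setP => //; rewrite ltW.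
  split.
    have -> : cross p u (path t) = (1 - t) * cross p u z + t * cross p u y.
      by rewrite /cross !coordE; ring.
    by apply: ltr_wpDl; [apply: mulr_ge0 => //; lra|exact: mulr_gt0].
  have -> : cross p (path t) v = (1 - t) * cross p z v + t * cross p y v.
    by rewrite /cross !coordE; ring.
  by apply: ltr_wpDl; [apply: mulr_ge0 => //; lra|exact: mulr_gt0].
have inD t : 0 < t -> t <= 1 -> connected_component (C `\` S) y (path t).
  move=> t0 t1.
  apply: (connected_component_max (B := segment (path t) y)).
  - exists 1 => /=; first by rewrite in_itv/= lexx ler01.
    by rewrite subrr scale0r scale1r add0r.
  - move=> _ [s /= s01 <-]; move: s01; rewrite in_itv/= => /andP[s0 s1].
    have -> : (1 - s) *: path t + s *: y = path (t + s * (1 - t)).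
      by apply: plane_ext; rewrite /path !coordE; ring.
    have [||CC OO] := opath (t + s * (1 - t)); [nra|nra|].
    by split => // /disj.
  - exact: segment_is_connected.
  - exists 0 => /=; first by rewrite in_itv/= lexx ler01.
    by rewrite subr0 scale0r scale1r addr0.
move=> B Bz.
have : nbhs (0 : R) (path @^-1` B).
  apply: segment_path_continuous.
  by rewrite subr0 scale1r scale0r addr0.
move=> /nbhs_ballP[e /= e0 eB].
have m0 : 0 < Num.min (e / 2) 1 by rewrite lt_min ltr01 divr_gt0.
exists (path (Num.min (e / 2) 1)); split.
  by apply: inD => //; rewrite ge_min lexx orbT.
apply: eB; rewrite /ball/= sub0r normrN gtr0_norm//.
by rewrite gt_min; apply/orP; left; lra.
Qed.

End Body.

(** * The angles [2 pi / k] *)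

Section Trigonometry.
Context {R : realType}.

(** [cos (pi / 3)] is a root of [4 X^3 - 3 X + 1 = (X + 1) (2 X - 1)^2] other than
    [-1]. *)
Lemma cos_two_thirds_pi : cos (2 * pi / 3%:R) = - (1 / 2) :> R.
Proof.
set a := pi / 3%:R : R.
have pi0 := pi_gt0 R.
have s0 : 0 < sin a by apply: sin_gt0_pi; rewrite /a; apply/andP; split; lra.
have E2 : 2 * pi / 3%:R = a + a by rewrite /a; lra.
have E3 : pi = a + a + a by rewrite /a; lra.
have := cospi R; rewrite {1}E3 cosD sinD cosD => h.
have := cos2Dsin2 a => h2.
have hc : -1 < cos a.
  by rewrite lt_neqAle cos_geN1 andbT; apply/eqP => E; move: h2; rewrite -E; nra.
have h3 : (cos a + 1) * (2 * cos a - 1) ^+ 2 = 0.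
  have -> : (cos a + 1) * (2 * cos a - 1) ^+ 2 = (cos a * cos a - sin a * sin a) * cos a
    - (sin a * cos a + cos a * sin a) * sin a + 1
    - 3 * cos a * (1 - (cos a ^+ 2 + sin a ^+ 2)) by ring.
  by rewrite h h2; ring.
have hc2 : cos a = 1 / 2.
  move/eqP: h3; rewrite mulf_eq0 sqrf_eq0 => /orP[] /eqP; lra.
by rewrite E2 cosD -[sin a * _]expr2 sin2cos2 hc2; lra.
Qed.

Lemma turn_in_0pi k : (2 <= k)%N -> 2 * pi / k%:R \in `[0, pi : R].
Proof.
move=> k2; have pi0 := pi_gt0 R.
have k0 : 2 <= k%:R :> R by rewrite ler_nat.
rewrite in_itv/= divr_ge0 ?mulr_ge0 ?pi_ge0//=.
by rewrite ler_pdivrMr; nra.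
Qed.

Lemma cos_turn_mono k l : (2 <= k)%N -> (k <= l)%N ->
  cos (2 * pi / k%:R) <= cos (2 * pi / l%:R) :> R.
Proof.
move=> k2 kl; have pi0 := pi_gt0 R.
rewrite leNgt ltr_cos ?turn_in_0pi ?(leq_trans k2)//.
rewrite -leNgt ler_wpM2l ?mulr_ge0 ?pi_ge0// lef_pV2 ?posrE ?ler_nat ?ltr0n//.
  exact: leq_trans (leq_trans k2 kl).
exact: leq_trans k2.
Qed.

Lemma cos_turn_ge k : (3 <= k)%N -> - (1 / 2) <= cos (2 * pi / k%:R) :> R.
Proof. by move=> k3; rewrite -cos_two_thirds_pi; exact: cos_turn_mono. Qed.

Lemma sin_turn_gt0 k : (3 <= k)%N -> 0 < sin (2 * pi / k%:R) :> R.
Proof.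
move=> k3; have pi0 := pi_gt0 R.
have k0 : 3 <= k%:R :> R by rewrite (ler_nat _ 3).
apply: sin_gt0_pi; rewrite divr_gt0 ?mulr_gt0//=; last lra.
by rewrite ltr_pdivrMr; nra.
Qed.

Lemma sin_turn_ge0 k : (2 <= k)%N -> 0 <= sin (2 * pi / k%:R) :> R.
Proof. by move=> k2; apply: sin_ge0_pi; have := turn_in_0pi k2; rewrite in_itv. Qed.

(** None of the [k] rays with directions [j * 2 pi / k] is strictly between the rays
    of indices 0 and 1: the two signs would put the angle of the ray strictly
    below [pi] and its predecessor strictly above. *)
Lemma sin_turn_sector k j : (2 <= k)%N -> (j < k)%N ->
  0 < sin (j%:R * (2 * pi / k%:R)) :> R ->
  0 < sin ((1 - j%:R) * (2 * pi / k%:R)) :> R -> False.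
Proof.
move=> k2 jk; have pi0 := pi_gt0 R.
have := turn_in_0pi k2; rewrite in_itv/=; set a := 2 * pi / k%:R => /andP[a0 a1] s1 s2.
have k0 : 0 < k%:R :> R by rewrite ltr0n (leq_trans _ k2).
have ka : k%:R * a = 2 * pi by rewrite /a mulrC divfK// gt_eqF.
case: j jk s1 s2 => [_|j jk s1 s2]; first by rewrite mul0r sin0 ltxx.
have E : (1 - j.+1%:R) * a = - (j%:R * a) by rewrite -natr1; ring.
move: s2; rewrite E sinN oppr_gt0 => s2.
have ja : pi < j%:R * a.
  rewrite ltNge; apply/negP => h; move: s2; apply/negP; rewrite -leNgt.
  by apply: sin_ge0_pi; rewrite h mulr_ge0.
have ja' : j.+1%:R * a <= 2 * pi by rewrite -ka ler_wpM2r// ler_nat ltnW.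
have : 0 <= sin (j.+1%:R * a - pi).
  apply: sin_ge0_pi; apply/andP; split; last lra.
  have : j%:R * a <= j.+1%:R * a by rewrite ler_wpM2r// ler_nat.
  lra.
by rewrite sinB cospi sinpi; lra.
Qed.

End Trigonometry.

(** * Symmetries of a body and their common center *)

Section Symmetry.
Context {R : realType}.
Local Notation plane := 'rV[R]_2.
Implicit Types (p q u v w x y z : plane) (a b t M : R) (C S : set plane) (k : nat).
Local Notation X := abscissa.
Local Notation Y := ordinate.

Lemma rotation_imageD C p a b : rotation p a @` C = C -> rotation p b @` C = C ->
  rotation p (a + b) @` C = C.
Proof.
move=> ha hb; rewrite -[RHS]ha -[in RHS]hb image_comp; apply: eq_imagel => y _ /=.
by rewrite rotationD.
Qed.

Lemma rotation_imageN C p a : rotation p a @` C = C -> rotation p (- a) @` C = C.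
Proof.
move=> ha; rewrite -[in LHS]ha image_comp -[RHS]image_id; apply: eq_imagel => y _ /=.
by rewrite rotationD addNr rotation0.
Qed.

Lemma rotation_imageMn C p a n : rotation p a @` C = C -> rotation p (n%:R * a) @` C = C.
Proof.
move=> ha; elim: n => [|n IH].
  by rewrite mul0r -[RHS]image_id; apply: eq_imagel => y _; rewrite rotation0.
by rewrite -natr1 mulrDl mul1r; exact: rotation_imageD.
Qed.

Lemma rotation_mem C p a y : rotation p a @` C = C -> C y -> C (rotation p a y).
Proof. by move=> {2}<- Cy; exists y. Qed.

Lemma symmetry_center_turn2 C p : symmetry_center C 2 p -> rotation p pi @` C = C.
Proof. by case=> _; rewrite mulrAC divff ?mul1r// pnatr_eq0. Qed.

Lemma rotation_fixpoint p q a : cos a < 1 -> rotation p a q = q -> q = p.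
Proof.
move=> ca E; apply: sqd_eq0.
have : sqd (rotation p a q) q = 2 * (1 - cos a) * sqd q p.
  by rewrite -cos2Dsin2_sub1 /sqd !coordE; ring.
rewrite E {1}/sqd !subrr expr0n /= addr0 => /esym/eqP.
by rewrite mulf_eq0 => /orP[/eqP|/eqP//]; lra.
Qed.

Lemma sqd_max C p : compact C -> C !=set0 ->
  exists2 z, C z & forall y, C y -> sqd p y <= sqd p z.
Proof.
move=> cC C0.
have [|z zC hz] := @compact_EVT_max _ R (sqd p) C C0 cC.
  by apply: continuous_subspaceT => y; exact: sqd_continuous.
by exists z => [|y Cy]; [rewrite inE in zC|apply: hz; rewrite inE].
Qed.

(** The linear form given by the inner product with the translation vector attains
    its maximum on [C], but translating increases it by the squared length of the
    vector. *)
Lemma translation_invariant_trivial C o q : compact C -> C !=set0 ->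
  (forall y, C y -> C (1 *: (1 *: y + 1 *: q) + -1 *: o)) -> q = o.
Proof.
move=> cC C0 tC; apply: sqd_eq0.
pose f y := (X q - X o) * X y + (Y q - Y o) * Y y + 0.
have [|z zC hz] := @compact_EVT_max _ R f C C0 cC.
  by apply: continuous_subspaceT => y; exact: affine_continuous.
have := hz (1 *: (1 *: z + 1 *: q) + -1 *: o); rewrite !inE in zC *.
move=> /(_ (tC _ zC)); rewrite /f !coordE => h.
apply/eqP; rewrite eq_le sqd_ge0 andbT /sqd; lra.
Qed.

(** Conjugating the half-turn about [o] by the rotation about [q] gives the half-turn
    about the image of [o]; the product of the two half-turns is a translation,
    hence trivial, so the rotation about [q] fixes [o]. *)
Lemma symmetry_center_unique C k o q : (2 <= k)%N -> compact C ->
  symmetry_center C 2 o -> symmetry_center C k q -> q = o.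
Proof.
move=> k2 cC so [Cq sq]; apply/esym; have so2 := symmetry_center_turn2 so.
apply: (@rotation_fixpoint _ _ (2 * pi / k%:R)); first exact: cos_turn_lt1.
pose a : R := 2 * pi / k%:R.
have sqN := rotation_imageN sq.
pose d := 1 *: (1 *: rotation q a o + 1 *: rotation q a o) + -1 *: o.
suff dE : d = o.
  have := congr1 X dE; have := congr1 Y dE; rewrite /d.
  rewrite !(abscissaE, ordinateE) => h1 h2; apply: plane_ext; rewrite -/a; lra.
apply: (@translation_invariant_trivial C) => //; first by exists q.
move=> y Cy.
have : C (rotation q a (rotation o pi (rotation q (- a) (rotation o pi y)))).
  do 4! apply: rotation_mem => //.
congr C; have E := cos2Dsin2 a.
rewrite !rotation_pi; apply: plane_ext; rewrite /d !coordE cosN sinN.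
- transitivity (X y + 2 * (X (rotation q a o) - X o) + (cos a ^+ 2 + sin a ^+ 2 - 1) *
     (X y - 2 * X o + X q)); [|rewrite E]; rewrite !coordE; ring.
- transitivity (Y y + 2 * (Y (rotation q a o) - Y o) + (cos a ^+ 2 + sin a ^+ 2 - 1) *
     (Y y - 2 * Y o + Y q)); [|rewrite E]; rewrite !coordE; ring.
Qed.

(** If [q] is an interior point, a point [y] close to [p] is the midpoint of the
    reflection of [q] and of [f y], which is close to [q]. *)
Lemma center_interior C p : convex_set C -> C° !=set0 -> symmetry_center C 2 p -> C° p.
Proof.
move=> vC [q qi] /symmetry_center_turn2 sp.
have Cq : C (2 *: p + -1 *: q).
  by rewrite -rotation_pi; apply: rotation_mem => //; exact: interior_subset qi.
pose f y := 1 *: (q : plane) + 2 *: (1 *: y + -1 *: p).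
have fp : f p = q by apply: plane_ext; rewrite /f !coordE; ring.
have cf : continuous f.
  move=> y; apply: (@continuousD _ _ _ (fun=> 1 *: q) (fun y => 2 *: (1 *: y + -1 *: p))).
    exact: cst_continuous.
  apply: (@continuousZl_tmp _ _ _ (fun y => 1 *: y + -1 *: p)).
  apply: (@continuousD _ _ _ (fun y => 1 *: y) (fun=> -1 *: p)); last exact: cst_continuous.
  by apply: (@continuousZl_tmp _ _ _ (fun y => y)); exact: cvg_id.
have : nbhs p (f @^-1` C) by apply: cf; rewrite fp.
apply: filterS => y Cfy.
have -> : y = (1 - 1 / 2) *: (2 *: p + -1 *: q) + (1 / 2) *: f y.
  by apply: plane_ext; rewrite /f !coordE; lra.
by apply: convex_setP => //; lra.
Qed.

(** Half of the turn of angle [2 pi / k] is a half-turn followed by [(k - 1) / 2]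
    backward turns of angle [2 pi / k]. *)
Lemma double_symmetry C k p : odd k -> symmetry_center C 2 p -> symmetry_center C k p ->
  symmetry_center C (2 * k) p.
Proof.
move=> ok s2 [Cp sk]; split=> //; have s2' := symmetry_center_turn2 s2.
have -> : 2 * pi / (2 * k)%:R = pi + - (k./2%:R * (2 * pi / k%:R)) :> R.
  have kE : k%:R = 1 + 2 * k./2%:R :> R.
    by rewrite -[in LHS](odd_double_half k) ok natrD -mul2n natrM.
  have k0 : 0 < k%:R :> R by rewrite ltr0n; case: k ok {sk kE}.
  rewrite natrM kE; field.
  by rewrite -kE gt_eqF.
apply: rotation_imageD => //; apply: rotation_imageN; exact: rotation_imageMn.
Qed.

(** The sectors cover the plane. Otherwise the cross products [f i] of the [i]-th ray
    with [y] would all have the same strict sign from some index on. But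
    [2 sin (pi / k) f i] is the increment [G i.+1 - G i] of a [k]-periodic
    sequence, which cannot be strictly monotone. *)
Lemma sector_cover p x y k : (2 <= k)%N -> exists i : nat,
  sector p (rotation p (i%:R * (2 * pi / k%:R)) x)
           (rotation p (i.+1%:R * (2 * pi / k%:R)) x) y.
Proof.
move=> k2; set a : R := 2 * pi / k%:R; have pi0 := pi_gt0 R.
have k0 : 0 < k%:R :> R by rewrite ltr0n (leq_trans _ k2).
have ka : k%:R * a = 2 * pi by rewrite /a mulrC divfK// gt_eqF.
pose f (i : nat) := cross p (rotation p (i%:R * a) x) y.
suff [i [fi fi1]] : exists i, 0 <= f i /\ f i.+1 <= 0.
  by exists i; split => //; rewrite crossC oppr_ge0.
apply: contrapT => nex.
pose G (i : nat) := cross p x y * sin ((i%:R - 1 / 2) * a) +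
  dot p x y * cos ((i%:R - 1 / 2) * a).
have s0 : 0 < sin (a / 2).
  apply: sin_gt0_pi; have k2' : 2 <= k%:R :> R by rewrite ler_nat.
  by apply/andP; split; nra.
have GS i : G i.+1 - G i = 2 * sin (a / 2) * f i.
  rewrite /G /f cross_rotationl.
  have -> : (i.+1%:R - 1 / 2) * a = i%:R * a + a / 2 by rewrite -natr1; lra.
  have -> : (i%:R - 1 / 2) * a = i%:R * a - a / 2 by lra.
  by rewrite sinD cosD sinB cosB; ring.
have Gk i : G (i + k)%N = G i.
  rewrite /G (_ : ((i + k)%:R - 1 / 2) * a = (i%:R - 1 / 2) * a + pi *+ 2).
    by rewrite sinD2pi cosD2pi.
  by rewrite natrD -[pi *+ 2]mulr_natl -ka; ring.
have mono (g : nat -> R) m : (forall i, g (m + i)%N < g (m + i.+1)%N) -> g m < g (m + k)%N.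
  move=> h; suff H n : g m < g (m + n.+1)%N by case: k k2 {k0 ka Gk GS a f G s0 nex}.
  elim: n => [|n IH]; first by have := h 0; rewrite addn0.
  exact: lt_trans IH (h _).
have [[i fi]|neg] := pselect (exists i, 0 <= f i).
  have pos n : 0 < f (i.+1 + n)%N.
    have step j : 0 <= f j -> 0 < f j.+1.
      by move=> fj; rewrite ltNge; apply/negP => fj1; apply: nex; exists j.
    by elim: n => [|n IH]; [rewrite addn0; exact: step|rewrite addnS; apply: step; exact: ltW].
  have := mono G i.+1; rewrite Gk ltxx => H; suff : false by []; apply: H => n.
  by rewrite -subr_gt0 addnS GS !mulr_gt0.
have := mono (fun i => - G i) 0; rewrite Gk ltxx => H; suff : false by []; apply: H => n.
rewrite ltrN2 -subr_lt0 addnS GS pmulr_rlt0 ?mulr_gt0// ltNge; apply/negP => fn.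
by apply: neg; exists (0 + n)%N.
Qed.

End Symmetry.

(** * Diameters of standard partitions *)

Section Diameters.
Context {R : realType}.
Local Notation plane := 'rV[R]_2.
Implicit Types (D : set plane) (P : set (set plane)) (M : R).

Definition sqd_bounded D M := forall y z, D y -> D z -> sqd y z <= M.

Lemma diameter_le D M : D !=set0 -> sqd_bounded D M -> diameter D <= Num.sqrt M.
Proof.
move=> [y0 Dy0] DM; apply: ge_sup; first by exists (eucl_dist y0 y0), y0 => //; exists y0.
by move=> _ [y Dy [z Dz <-]]; rewrite eucl_distE; apply: ler_wsqrtr; exact: DM.
Qed.

Lemma le_diameter D M y z : sqd_bounded D M -> D y -> D z ->
  Num.sqrt (sqd y z) <= diameter D.
Proof.
move=> DM Dy Dz; apply: ub_le_sup; last by exists y => //; exists z; rewrite ?eucl_distE.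
exists (Num.sqrt M) => _ [u Du [v Dv <-]].
by rewrite eucl_distE; apply: ler_wsqrtr; exact: DM.
Qed.

Lemma max_rel_diameter_le P M : P !=set0 -> (forall D, P D -> D !=set0) ->
  (forall D, P D -> sqd_bounded D M) -> max_rel_diameter P <= Num.sqrt M.
Proof.
move=> [D PD] Pn PM; apply: ge_sup; first by exists (diameter D), D.
by move=> _ [D' PD' <-]; apply: diameter_le; [exact: Pn|exact: PM].
Qed.

Lemma le_max_rel_diameter P D M y z : (forall D, P D -> D !=set0) ->
  (forall D, P D -> sqd_bounded D M) -> P D -> D y -> D z ->
  Num.sqrt (sqd y z) <= max_rel_diameter P.
Proof.
move=> Pn PM PD Dy Dz; apply: (le_trans (le_diameter (PM D PD) Dy Dz)).
apply: ub_le_sup; last by exists D.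
by exists (Num.sqrt M) => _ [D' PD' <-]; apply: diameter_le; [exact: Pn|exact: PM].
Qed.

End Diameters.

Section StandardPartition.
Context {R : realType}.
Local Notation plane := 'rV[R]_2.
Variables (C : set plane) (p x : plane) (k : nat).
Hypotheses (convexC : convex_set C) (compactC : compact C) (interior_p : C° p)
  (k_ge2 : (2 <= k)%N) (symC : symmetry_center C k p)
  (nearest_x : nearest_boundary_point C p x).
Local Notation turn := (2 * pi / k%:R).
Local Notation foot j := (rotation p (j%:R * turn) x).

Lemma closed_body : closed C.
Proof. by apply: compact_closed => //; exact: norm_hausdorff. Qed.

Lemma mem_center : C p. Proof. by case: symC. Qed.

Lemma mem_foot0 : C x.
Proof. by case: nearest_x => -[+ _] _; rewrite -(closure_id C).1//; exact: closed_body. Qed.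

Lemma inradius_gt0 : 0 < sqd p x.
Proof.
rewrite lt_neqAle sqd_ge0 andbT eq_sym; apply/eqP => /sqd_eq0 E.
by case: nearest_x => -[_]; rewrite -E.
Qed.

Lemma mem_turn j y : C y -> C (rotation p (j%:R * turn) y).
Proof. by case: symC => _ sC; apply: rotation_mem; exact: rotation_imageMn. Qed.

Lemma mem_turnN j y : C y -> C (rotation p (- (j%:R * turn)) y).
Proof.
by case: symC => _ sC; apply: rotation_mem; apply: rotation_imageN; exact: rotation_imageMn.
Qed.

(** Rotating back the foot to [x] keeps the point [y] in [C]. *)
Lemma foot_tangent j y : C y -> dot p (foot j) y <= sqd p (foot j).
Proof.
move=> Cy; rewrite sqd_rotation -(dot_rotation2 p (- (j%:R * turn))) rotationD addNr rotation0.
apply: (support_tangent convexC); first by case: nearest_x.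
  by apply: (ball_subset mem_center) => //; exact: closed_body.
exact: mem_turnN.
Qed.

Lemma segment_foot_cuts j : segment p (foot j) `<=` cuts k p x.
Proof.
move=> y sy; exists (j %% k)%N => /=; first by rewrite ltn_mod (leq_trans _ k_ge2).
suff -> : rotation p ((j %% k)%:R * turn) x = foot j by [].
rewrite -(rotation_periodic _ _ (j %/ k)%N); congr rotation.
rewrite {3}(divn_eq j k) natrD natrM; field.
by rewrite pnatr_eq0 -lt0n (leq_trans _ k_ge2).
Qed.

Lemma cross_foot i j : cross p (foot i) (foot j) = sin ((j%:R - i%:R) * turn) * sqd p x.
Proof. by rewrite rotation_cross mulrBl. Qed.

Lemma dot_foot i j : dot p (foot i) (foot j) = cos ((j%:R - i%:R) * turn) * sqd p x.
Proof. by rewrite rotation_dot mulrBl. Qed.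

Lemma foot0 : foot 0%N = x.
Proof. by rewrite mul0r rotation0. Qed.

Lemma sqd_foot1 : sqd x (foot 1%N) = 2 * sqd p x * (1 - cos turn).
Proof.
rewrite (sqd_dot p).
have -> : dot p x (foot 1%N) = cos turn * sqd p x.
  by have := dot_foot 0%N 1%N; rewrite foot0 subr0 mul1r.
by rewrite sqd_rotation; ring.
Qed.

Lemma cuts_open_sector q : cuts k p x q -> ~ open_sector p (foot 0%N) (foot 1%N) q.
Proof.
move=> [j /= jk [t /=]]; rewrite in_itv/= => /andP[t0 _] <- [].
have -> : cross p (foot 0%N) ((1 - t) *: p + t *: foot j) = t * cross p (foot 0%N) (foot j).
  by rewrite /cross !(abscissaE, ordinateE); ring.
have -> : cross p ((1 - t) *: p + t *: foot j) (foot 1%N) = t * cross p (foot j) (foot 1%N).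
  by rewrite /cross !(abscissaE, ordinateE); ring.
rewrite !cross_foot subr0 => h1 h2.
have r0 := inradius_gt0.
have t1 : 0 < t.
  by rewrite lt_neqAle t0 andbT; apply/eqP => E; rewrite -E mul0r ltxx in h1.
move: h1 h2; rewrite !(pmulr_rgt0 _ t1) !(pmulr_lgt0 _ r0).
exact: sin_turn_sector.
Qed.

(** At half the inradius, this point is inside the inscribed disk, hence in [C]; it
    marks the first piece. *)
Let bisector := (1 - 1 / 2) *: p + (1 / 2) *: rotation p (turn / 2) x.

Lemma bisector_sector : C bisector /\ open_sector p (foot 0%N) (foot 1%N) bisector.
Proof.
have r0 := inradius_gt0.
split.
  apply: (ball_subset mem_center nearest_x closed_body).
  by rewrite sqd_segment sqd_rotation; lra.
have s0 : 0 < sin (turn / 2) :> R.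
  have := turn_in_0pi k_ge2 (R := R); have := pi_gt0 R; rewrite in_itv/= => pi0 /andP[a0 a1].
  apply: sin_gt0_pi; apply/andP; split; last lra.
  by rewrite !divr_gt0// ?mulr_gt0// ltr0n (leq_trans _ k_ge2).
split; rewrite /bisector.
  have -> z : cross p (foot 0%N) ((1 - 1 / 2) *: p + (1 / 2) *: z) =
      1 / 2 * cross p (foot 0%N) z.
    by rewrite /cross !(abscissaE, ordinateE); ring.
  by rewrite rotation_cross mul0r subr0 !mulr_gt0.
have -> z : cross p ((1 - 1 / 2) *: p + (1 / 2) *: z) (foot 1%N) =
    1 / 2 * cross p z (foot 1%N).
  by rewrite /cross !(abscissaE, ordinateE); ring.
rewrite rotation_cross (_ : 1 * turn - turn / 2 = turn / 2); last lra.
by rewrite !mulr_gt0.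
Qed.

Lemma piece_subset D : pieces C (cuts k p x) D -> D !=set0 /\ D `<=` C.
Proof.
move=> [y CSy <-]; split.
  by exists y; apply: subset_closure; exact: connected_component_refl.
rewrite [X in _ `<=` X](closure_id C).1; last exact: closed_body.
by apply: closureS => z /connected_component_sub[].
Qed.

Lemma first_piece : exists2 D, pieces C (cuts k p x) D &
  C `&` sector p (foot 0%N) (foot 1%N) `<=` D.
Proof.
have [Cb sb] := bisector_sector.
exists (closure (connected_component (C `\` cuts k p x) bisector)).
  by exists bisector => //; split => // /cuts_open_sector.
exact: sector_subset_closure_component Cb sb cuts_open_sector.
Qed.

Variable z0 : plane.
Hypotheses (Cz0 : C z0) (z0_max : forall y, C y -> sqd p y <= sqd p z0).

(** A farthest point is in some sector; a rotation brings it to the first one. *)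
Lemma first_piece_points : exists D z, [/\ pieces C (cuts k p x) D, sqd p z = sqd p z0,
  D p /\ D z, D x & D (foot 1%N)].
Proof.
have [D PD sD] := first_piece.
have [i si] := sector_cover p x z0 k_ge2.
have s1 : 0 <= cross p (foot 0%N) (foot 1%N).
  by rewrite cross_foot subr0 mul1r mulr_ge0 ?sqd_ge0// sin_turn_ge0.
have cxx q : cross p q q = 0 by rewrite /cross; ring.
have cpx q : cross p q p = 0 by rewrite /cross; ring.
have cxp q : cross p p q = 0 by rewrite /cross; ring.
exists D, (rotation p (- (i%:R * turn)) z0); split => //.
- exact: sqd_rotation.
- split; first by apply: sD; split; [exact: mem_center|split; rewrite ?cpx ?cxp].
  apply: sD; split; first exact: mem_turnN.
  case: si => [+ +]; rewrite -(cross_rotation2 p (- (i%:R * turn)) (foot i)) rotationD => si1.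
  rewrite -(cross_rotation2 p (- (i%:R * turn)) z0) rotationD => si2.
  have e0 : 0%:R * turn = - (i%:R * turn) + i%:R * turn :> R by rewrite addNr mul0r.
  have e1 : 1%:R * turn = - (i%:R * turn) + i.+1%:R * turn :> R by rewrite -natr1; ring.
  by rewrite e0 e1; split.
- rewrite -foot0; apply: sD; split; first by rewrite foot0; exact: mem_foot0.
  by split; rewrite // cxx.
- apply: sD; split; first by apply: mem_turn; exact: mem_foot0.
  by split; rewrite // cxx.
Qed.

Let P := pieces C (cuts k p x).

(** A crude bound, ensuring that the suprema are those of bounded sets. *)
Lemma pieces_sqd_bounded D : P D -> sqd_bounded D (4 * sqd p z0).
Proof.
move=> /piece_subset[_ DC] y z /DC/z0_max hy /DC/z0_max hz.
have : sqd y z <= 2 * sqd p y + 2 * sqd p z.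
  rewrite (sqd_dot p); have : 0 <= sqd p y + sqd p z + 2 * dot p y z.
    rewrite (_ : _ + _ = (abscissa y - abscissa p + (abscissa z - abscissa p)) ^+ 2 +
      (ordinate y - ordinate p + (ordinate z - ordinate p)) ^+ 2).
      by rewrite addr_ge0 ?sqr_ge0.
    by rewrite /sqd /dot; ring.
  lra.
lra.
Qed.

Lemma le_max_rel_diameter_pieces D y z : P D -> D y -> D z ->
  Num.sqrt (sqd y z) <= max_rel_diameter P.
Proof.
apply: le_max_rel_diameter; last exact: pieces_sqd_bounded.
by move=> D' /piece_subset[].
Qed.

Lemma max_rel_diameter_ge :
  Num.sqrt (Num.max (sqd p z0) (2 * sqd p x * (1 - cos turn))) <= max_rel_diameter P.
Proof.
have [D [z [PD <- [Dp Dz] Dx Dx1]]] := first_piece_points.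
by rewrite -sqd_foot1 maxEle; case: ifP => _; exact: (le_max_rel_diameter_pieces PD).
Qed.

Lemma max_rel_diameter_le_kite : (3 <= k)%N ->
  max_rel_diameter P <= Num.sqrt (Num.max (sqd p z0) (2 * sqd p x * (1 - cos turn))).
Proof.
move=> k3; set M := Num.max _ _.
have Rm : sqd p z0 <= M by rewrite le_max lexx.
have Fm : 2 * sqd p x * (1 - cos turn) <= M by rewrite le_max lexx orbT.
apply: max_rel_diameter_le => [|D /piece_subset[]//|D].
  by have [D PD _] := first_piece; exists D.
move=> [y CSy <-].
have [i si] := sector_cover p x y k_ge2.
have r0 := inradius_gt0.
have ii : (i.+1%:R - i%:R) * turn = turn :> R by rewrite -natr1; ring.
have ci : 0 < cross p (foot i) (foot i.+1).
  by rewrite cross_foot ii mulr_gt0// sin_turn_gt0.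
have sub := component_subset_sector ci (@foot_tangent i) (@foot_tangent i.+1)
  (@segment_foot_cuts i) (@segment_foot_cuts i.+1) CSy si.
set Q := closure _.
have QC : Q `<=` C by apply: (@piece_subset Q _).2; exists y.
have Qs : Q `<=` sector p (foot i) (foot i.+1).
  rewrite [X in _ `<=` X](closure_id _).1; last exact: closed_sector.
  exact: closureS.
have xR : sqd p x <= M by apply: le_trans Rm; apply: z0_max; exact: mem_foot0.
move=> u v Qu Qv.
apply: (@kite_diameter _ p (foot i) (foot i.+1) _ _ (cos turn)); rewrite ?sqd_rotation//.
- exact: cos_turn_ge.
- exact: cos_turn_lt1.
- by rewrite dot_foot ii.
- rewrite (sqd_dot p) dot_foot ii !sqd_rotation; apply: le_trans Fm.
  by rewrite le_eqVlt; apply/orP; left; apply/eqP; ring.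
- exact: Qs.
- by rewrite -(sqd_rotation p (i%:R * turn)); apply: foot_tangent; exact: QC.
- by rewrite -(sqd_rotation p (i.+1%:R * turn)); apply: foot_tangent; exact: QC.
- by apply: le_trans Rm; apply: z0_max; exact: QC.
- exact: Qs.
- by rewrite -(sqd_rotation p (i%:R * turn)); apply: foot_tangent; exact: QC.
- by rewrite -(sqd_rotation p (i.+1%:R * turn)); apply: foot_tangent; exact: QC.
- by apply: le_trans Rm; apply: z0_max; exact: QC.
Qed.

(** [M] stands for the squared chord of a partition with at least three pieces. The
    half contains two antipodal feet, at distance [2 r], and a farthest point [z],
    whose squared distances to the feet add up to [2 (r^2 + d^2)]. *)
Lemma max_rel_diameter_half_gt M : k = 2 -> M <= 3 * sqd p x ->
  Num.sqrt (Num.max (sqd p z0) M) < max_rel_diameter P.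
Proof.
move=> kE Mx; have r0 := inradius_gt0.
have [D [z [PD zE [Dp Dz] Dx Dx1]]] := first_piece_points.
set m := max_rel_diameter P.
have m0 : 0 <= m by apply: le_trans max_rel_diameter_ge; exact: sqrtr_ge0.
have le y w : D y -> D w -> sqd y w <= m ^+ 2.
  move=> Dy Dw; rewrite -(sqr_sqrtr (sqd_ge0 y w)) ler_sqr ?nnegrE ?sqrtr_ge0//.
  exact: (le_max_rel_diameter_pieces PD).
have f1 : foot 1%N = 2 *: p + -1 *: x.
  by rewrite -rotation_pi kE; congr rotation; field.
have h1 := le _ _ Dx Dx1; have h2 := le _ _ Dx Dz; have h3 := le _ _ Dx1 Dz.
have E4 : sqd x (foot 1%N) = 4 * sqd p x.
  by rewrite f1 /sqd !(abscissaE, ordinateE); ring.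
have Epar : sqd x z + sqd (foot 1%N) z = 2 * (sqd p x + sqd p z).
  by rewrite f1 /sqd !(abscissaE, ordinateE); ring.
clear kE.
have m1 : 0 < m ^+ 2 by lra.
rewrite -[m]ger0_norm// -sqrtr_sqr ltr_sqrt//.
by rewrite gt_max; apply/andP; split; lra.
Qed.

End StandardPartition.

Theorem lemma3p12 (R : realType) (C : set 'rV[R]_2) (kC : nat) (ks : seq nat)
    (P : nat -> set (set 'rV[R]_2))
    (C_body : convex_body C)
    (C_multi : multi_rot_symmetric C)
    (C_not_disk : ~ is_disk C)
    (C_max : maximal_degree C kC)
    (C_min : minimal_degree C 2)
    (ks_sorted : sorted ltn ks)
    (ks_divisors : forall k, (k \in ks) = (1 < k)%N && (k %| kC)%N)
    (P_standard : forall k, k \in ks -> standard_partition C k (P k)) :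
  max_rel_diameter (P (nth 0%N ks 1)) < max_rel_diameter (P 2%N) /\
  (forall i, (1 <= i)%N -> (i.+1 < size ks)%N ->
     max_rel_diameter (P (nth 0%N ks i.+1)) <= max_rel_diameter (P (nth 0%N ks i))).
Proof.
have [compactC convexC interiorC] := C_body.
have [[_ [c sc]] _] := C_min.
have [[kC_ge2 [q sq]] kC_max] := C_max.
have qc : q = c := symmetry_center_unique kC_ge2 compactC sc sq.
rewrite {q}qc in sq.
have int_c := center_interior convexC interiorC sc.
have kC_even : (2 %| kC)%N.
  rewrite dvdn2; apply/negP => kC_odd.
  have : rot_symmetric C (2 * kC).
    split; last by exists c; exact: double_symmetry.
    by rewrite mul2n -addnn (leq_trans kC_ge2)// leq_addr.
  by move/kC_max; rewrite leqNgt ltn_Pmull// (leq_trans _ kC_ge2).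
have kC_gt2 : (2 < kC)%N.
  have [k [l [kl kS lS]]] := C_multi.
  rewrite ltn_neqAle kC_ge2 andbT; apply/eqP => kC2.
  apply: kl; apply/eqP; move: (kC_max _ kS) (kC_max _ lS) (proj1 kS) (proj1 lS).
  rewrite -kC2 => k2 l2 k2' l2'.
  by rewrite (_ : k = 2%N) 1?(_ : l = 2%N)//; apply/eqP; rewrite eqn_leq ?k2 ?l2.
have ks2 : 2%N \in ks by rewrite ks_divisors.
have ksC : kC \in ks by rewrite ks_divisors kC_ge2 dvdnn.
have ks_gt1 : (1 < size ks)%N.
  case: ks ks2 ksC {ks_sorted ks_divisors P_standard} => [|a [|b s]]//.
  by rewrite !inE => /eqP <- /eqP E; rewrite E ltnn in kC_gt2.
have nth_lt i j : (i < j < size ks)%N -> (nth 0%N ks i < nth 0%N ks j)%N.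
  move=> /andP[ij js]; apply: (sorted_ltn_nth ltn_trans) => //.
  by rewrite inE (ltn_trans ij).
have nth_gt1 i : (i < size ks)%N -> (1 < nth 0%N ks i)%N.
  by move=> /(mem_nth 0%N); rewrite ks_divisors => /andP[].
have nth_gt2 i : (0 < i < size ks)%N -> (2 < nth 0%N ks i)%N.
  move=> /andP[i0 ii]; apply: leq_ltn_trans (nth_lt 0%N i _); last by rewrite i0.
  by apply: nth_gt1; exact: ltn_trans ii.
have [z Cz z_max] := sqd_max c compactC (ex_intro _ c (interior_subset int_c)).
have std k : k \in ks -> exists x, [/\ symmetry_center C k c, nearest_boundary_point C c x
    & P k = pieces C (cuts k c x)].
  move=> kks; have [p [x [sp nx ->]]] := P_standard _ kks.
  have k2 : (2 <= k)%N by move: kks; rewrite ks_divisors => /andP[].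
  by have pc := symmetry_center_unique k2 compactC sc sp; rewrite pc in sp nx *; exists x.
have [x2 [s2 n2 P2]] := std _ ks2.
have same_radius x : nearest_boundary_point C c x -> sqd c x = sqd c x2.
  move=> [bx hx]; have [bx2 hx2] := n2; move: (hx _ bx2) (hx2 _ bx).
  rewrite !eucl_distE !ler_sqrt ?sqd_ge0// => h1 h2.
  by apply/eqP; rewrite eq_le h1 h2.
(* The square of the maximum relative diameter of [P k], for [k >= 3]. *)
pose value k := Num.max (sqd c z) (2 * sqd c x2 * (1 - cos (2 * pi / k%:R))).
have upper k : k \in ks -> (3 <= k)%N -> max_rel_diameter (P k) <= Num.sqrt (value k).
  move=> /std[x [sx nx ->]] k3; rewrite /value -(same_radius _ nx).
  by apply: max_rel_diameter_le_kite => //; exact: ltnW.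
have lower k : k \in ks -> (2 <= k)%N -> Num.sqrt (value k) <= max_rel_diameter (P k).
  move=> /std[x [sx nx ->]] k2; rewrite /value -(same_radius _ nx).
  exact: max_rel_diameter_ge.
split=> [|i i1 szi].
  have k3 : (2 < nth 0%N ks 1)%N by apply: nth_gt2.
  apply: (le_lt_trans (upper _ (mem_nth 0%N ks_gt1) k3)).
  rewrite P2; apply: max_rel_diameter_half_gt => //.
  by have := cos_turn_ge k3 (R := R); have := sqd_ge0 c x2; nra.
have k3 : (2 < nth 0%N ks i)%N by apply: nth_gt2; rewrite i1 ltnW.
have kl : (nth 0%N ks i < nth 0%N ks i.+1)%N by apply: nth_lt; rewrite ltnSn.
apply: (le_trans (upper _ (mem_nth 0%N szi) (ltn_trans k3 kl))).
apply: le_trans (lower _ (mem_nth 0%N (ltnW szi)) (ltnW k3)).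
apply: ler_wsqrtr; rewrite ge_max !le_max lexx /=; apply/orP; right.
apply: ler_wpM2l; first by rewrite mulr_ge0 ?sqd_ge0.
by rewrite lerB// cos_turn_mono// ltnW.
Qed.
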